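(* Let $(M,g)$ be the Hayward black hole spacetime with parameters $m>0$, $b>0$: coordinates $(t,r,\theta,\phi)$ and $g=-\frac{B}{B_1}dt^2+\frac{B_1}{B}dr^2+r^2(d\theta^2+\sin^2\theta\, d\phi^2)$, where $B=2b^2m+r^2(r-2m)$, $B_1=2b^2m+r^3$, on the domain $r>0$, $0<\theta<\pi$, $B\neq 0$. Then $M$ is neither Einstein nor quasi-Einstein, but (i) $M$ is $2$-quasi-Einstein with $\alpha=-\frac{12b^2m^2}{B_1^2}$, i.e. $S-\alpha g$ has rank $2$; (ii) $M$ is generalized quasi-Einstein in the sense of Chaki, i.e. $S=\alpha g+\beta\,\Pi\otimes\Pi+\gamma(\Pi\otimes\Phi+\Phi\otimes\Pi)$, with $\alpha=-\frac{12b^2m^2}{B_1^2}$, $\beta=1$, $\gamma=1$, and $1$-forms having components (with respect to $dt,dr,d\theta,d\phi$) $\Pi=\left(-\frac{B}{B_1},1,0,0\right)$ and $\Phi=\left(\frac{36b^2m^2r^3+B_1^2B}{2B_1^3},\ \frac{18b^2m^2r^3}{B_1^2B}-\frac12,\ 0,\ 0\right)$.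
   Context: A semi-Riemannian manifold with Ricci tensor $S$ is Einstein (resp. quasi-Einstein, $2$-quasi-Einstein) if there is a scalar function $\alpha$ such that $S-\alpha g$ has rank $0$ (resp. $1$, $2$). Sign of curvature: $R_{pq\mu\nu}=g_{p\alpha}(\partial_\mu\Gamma^\alpha_{q\nu}-\partial_\nu\Gamma^\alpha_{q\mu}+\Gamma^\beta_{q\nu}\Gamma^\alpha_{\beta\mu}-\Gamma^\beta_{q\mu}\Gamma^\alpha_{\beta\nu})$; Ricci tensor $S_{q\mu}=g^{p\nu}R_{pq\mu\nu}$. With this convention, for the present metric, $S_{33}=-\frac{12b^2m^2r^2}{B_1^2}$ (so $S$ is the negative of the Ricci tensor in the convention where round spheres have positive Ricci curvature). *)

(* Defs.v *)
From mathcomp Require Import all_boot all_order all_algebra.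
From mathcomp Require Import boolp classical_sets reals topology normedtype.
From mathcomp Require Import derive trigo.

Set Implicit Arguments.
Unset Strict Implicit.
Unset Printing Implicit Defensive.

Import Order.TTheory GRing.Theory Num.Theory.
Import numFieldNormedType.Exports.

Local Open Scope ring_scope.
Local Open Scope classical_set_scope.

(** Semi-Riemannian geometry in one coordinate chart: a point is its row of
    coordinates in ['rV[R]_n], the chart domain is a set [M] of such points, a
    (0,2)-tensor field is a matrix-valued function, and a 1-form is a function
    giving the row of its components. *)

Definition partial (R : realType) (n : nat) (i : 'I_n) (f : 'rV[R]_n -> R)
    (x : 'rV[R]_n) : R :=
  'D_(delta_mx 0 i) f x.

(** [christoffel g a b c x] is Gamma^a_{bc} at [x]. *)
Definition christoffel (R : realType) (n : nat) (g : 'rV[R]_n -> 'M[R]_n)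
    (a b c : 'I_n) (x : 'rV[R]_n) : R :=
  2^-1 * \sum_(d < n) invmx (g x) a d *
    (partial b (fun y => g y d c) x + partial c (fun y => g y d b) x
     - partial d (fun y => g y b c) x).

(** [riemann g p q mu nu x] is the component R_{p q mu nu} at [x]. *)
Definition riemann (R : realType) (n : nat) (g : 'rV[R]_n -> 'M[R]_n)
    (p q mu nu : 'I_n) (x : 'rV[R]_n) : R :=
  \sum_(a < n) g x p a *
    (partial mu (christoffel g a q nu) x - partial nu (christoffel g a q mu) x
     + \sum_(b < n) christoffel g b q nu x * christoffel g a b mu x
     - \sum_(b < n) christoffel g b q mu x * christoffel g a b nu x).

(** S_{q mu} = g^{p nu} R_{p q mu nu}.  This contracts the first and last
    indices, so [ricci] is the opposite of the Ricci tensor that is positive on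
    round spheres. *)
Definition ricci (R : realType) (n : nat) (g : 'rV[R]_n -> 'M[R]_n)
    (x : 'rV[R]_n) : 'M[R]_n :=
  \matrix_(q, mu) \sum_(p < n) \sum_(nu < n)
    invmx (g x) p nu * riemann g p q mu nu x.

Definition ricci_rank_with (R : realType) (n k : nat) (M : set 'rV[R]_n)
    (g : 'rV[R]_n -> 'M[R]_n) (alpha : 'rV[R]_n -> R) : Prop :=
  forall x, M x -> \rank (ricci g x - alpha x *: g x) = k.

Definition einstein (R : realType) (n : nat) (M : set 'rV[R]_n)
    (g : 'rV[R]_n -> 'M[R]_n) : Prop :=
  exists alpha, ricci_rank_with 0 M g alpha.

Definition quasi_einstein (R : realType) (n : nat) (M : set 'rV[R]_n)
    (g : 'rV[R]_n -> 'M[R]_n) : Prop :=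
  exists alpha, ricci_rank_with 1 M g alpha.

Definition two_quasi_einstein_with (R : realType) (n : nat) (M : set 'rV[R]_n)
    (g : 'rV[R]_n -> 'M[R]_n) (alpha : 'rV[R]_n -> R) : Prop :=
  ricci_rank_with 2 M g alpha.

Definition form_tensor (R : realType) (n : nat) (u v : 'rV[R]_n) : 'M[R]_n :=
  u^T *m v.

Definition chaki_generalized_quasi_einstein_with (R : realType) (n : nat)
    (M : set 'rV[R]_n) (g : 'rV[R]_n -> 'M[R]_n)
    (alpha beta gamma : 'rV[R]_n -> R) (Pi Phi : 'rV[R]_n -> 'rV[R]_n) : Prop :=
  forall x, M x ->
    ricci g x = alpha x *: g x
                + beta x *: form_tensor (Pi x) (Pi x)
                + gamma x *: (form_tensor (Pi x) (Phi x)
                              + form_tensor (Phi x) (Pi x)).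

(** Coordinates (t, r, theta, phi) are the entries 0, 1, 2, 3 of a point. *)
Definition row4 (R : realType) (a0 a1 a2 a3 : R) : 'rV[R]_4 :=
  \row_(i < 4) [:: a0; a1; a2; a3]`_i.

Definition r_coord (R : realType) (x : 'rV[R]_4) : R := x 0 1.
Definition theta_coord (R : realType) (x : 'rV[R]_4) : R := x 0 2.

Definition hayward_B (R : realType) (m b : R) (r : R) : R :=
  2 * b ^+ 2 * m + r ^+ 2 * (r - 2 * m).

Definition hayward_B1 (R : realType) (m b : R) (r : R) : R :=
  2 * b ^+ 2 * m + r ^+ 3.

Definition hayward_domain (R : realType) (m b : R) : set 'rV[R]_4 :=
  [set x | [/\ 0 < r_coord x, 0 < theta_coord x < pi
             & hayward_B m b (r_coord x) != 0]].

Definition hayward_metric (R : realType) (m b : R) (x : 'rV[R]_4) : 'M[R]_4 :=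
  let r := r_coord x in
  let B := hayward_B m b r in
  let B1 := hayward_B1 m b r in
  diag_mx (row4 (- (B / B1)) (B1 / B) (r ^+ 2)
                (r ^+ 2 * sin (theta_coord x) ^+ 2)).

Definition hayward_alpha (R : realType) (m b : R) (x : 'rV[R]_4) : R :=
  - (12 * b ^+ 2 * m ^+ 2 / hayward_B1 m b (r_coord x) ^+ 2).

Definition hayward_Pi (R : realType) (m b : R) (x : 'rV[R]_4) : 'rV[R]_4 :=
  let r := r_coord x in
  let B := hayward_B m b r in
  let B1 := hayward_B1 m b r in
  row4 (- (B / B1)) 1 0 0.

Definition hayward_Phi (R : realType) (m b : R) (x : 'rV[R]_4) : 'rV[R]_4 :=
  let r := r_coord x in
  let B := hayward_B m b r in
  let B1 := hayward_B1 m b r in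
  row4 ((36 * b ^+ 2 * m ^+ 2 * r ^+ 3 + B1 ^+ 2 * B) / (2 * B1 ^+ 3))
       (18 * b ^+ 2 * m ^+ 2 * r ^+ 3 / (B1 ^+ 2 * B) - 2^-1) 0 0.

(* Main.v *)
(* For a static metric -f dt^2 + dr^2/f + r^2 (dtheta^2 + sin^2 theta dphi^2)
   every Christoffel symbol is a function of r times a function of theta, so
   the curvature reduces to one-variable derivatives. The Ricci tensor is
   diagonal, with one eigenvalue on the (t, r)-plane and another on the
   (theta, phi)-plane. For the Hayward lapse f = B / B1 the latter is alpha and
   the two differ by 36 b^2 m^2 r^3 / B1^3, which never vanishes: S - c g then
   has even rank, which is 2 for c = alpha and never 0. *)

Require Import Defs.
From mathcomp Require Import all_boot all_order all_algebra.
From mathcomp Require Import boolp classical_sets functions reals topology normedtype.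
From mathcomp Require Import derive realfun trigo ring lra.
Import Order.TTheory GRing.Theory Num.Theory.
Import numFieldNormedType.Exports.
Local Open Scope ring_scope.
Local Open Scope classical_set_scope.

Set Implicit Arguments.
Unset Strict Implicit.
Unset Printing Implicit Defensive.

(** * Diagonal matrices, one-variable derivatives, and curvature contractions *)

Lemma mxrank_diag (F : fieldType) (n : nat) (d : 'rV[F]_n) :
  \rank (diag_mx d) = (\sum_(i < n) (d 0%R i != 0%R))%N.
Proof.
elim: n d => [|n IHn] d; first by rewrite big_ord0 flatmx0 mxrank0.
have /(congr1 mxrank) := diag_mx_row (lsubmx (d : 'rV_(1 + n))) (rsubmx (d : 'rV_(1 + n))).
rewrite hsubmxK rank_diag_block_mx IHn => ->.
rewrite big_ord_recl; congr (_ + _)%N.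
  rewrite rank_rV; congr nat_of_bool; apply/idP/idP; apply: contra => /eqP.
    move=> d0; apply/eqP/rowP => i; rewrite !ord1 !mxE.
    by rewrite (_ : lshift n 0 = 0) ?d0 ?mul0rn //; exact: val_inj.
  move/rowP/(_ 0); rewrite !mxE eqxx mulr1n => <-.
  by apply/eqP; congr (d 0 _); exact: val_inj.
apply: eq_bigr => i _; rewrite !mxE.
by congr (d 0 _ != 0 : nat); exact: val_inj.
Qed.

(** Both sides have the same difference quotient. This brings partial derivatives into one-variable
    calculus. *)
Lemma derive_line (R : realType) (n : nat) (f : 'rV[R]_n -> R) (x v : 'rV[R]_n) :
  'D_v f x = 'D_1 (fun h : R => f (h *: v + x)) 0.
Proof.
rewrite /derive; set q := (fun h => _); set p := (fun h => _).
suff -> : q = p by [].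
by apply/funext => h; rewrite /q /p /= scale0r add0r addr0 [h *: 1]mulr1.
Qed.

Lemma is_derive1_mul (R : realType) (u w : R -> R) (x du dw : R) :
  is_derive x 1 u du -> is_derive x 1 w dw ->
  is_derive x 1 (fun y => u y * w y) (du * w x + u x * dw).
Proof.
move=> Du Dw; apply: is_derive_eq (is_deriveM Du Dw) _.
by rewrite /GRing.scale /=; ring.
Qed.

(** Along the line [h *: delta_mx 0 k + x] the coordinate [l] is [h * (k == l)%:R + x 0 l], so the
    chain rule produces the indicators and the product rule does the rest. *)
Lemma partial_separated (R : realType) (n : nat) (u w : R -> R) (du dw : R) (x : 'rV[R]_n)
    (i j k : 'I_n) :
    is_derive (x 0 i) 1 u du -> is_derive (x 0 j) 1 w dw ->
  partial k (fun y => u (y 0 i) * w (y 0 j)) x =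
    (k == i)%:R * (du * w (x 0 j)) + (k == j)%:R * (u (x 0 i) * dw).
Proof.
move=> Du Dw; rewrite /partial derive_line.
have D (v : R -> R) dv l : is_derive (x 0 l) 1 v dv ->
    is_derive (0 : R) (1 : R) (fun h => v ((h *: delta_mx 0 k + x) 0 l)) (dv * (k == l)%:R).
  move=> Dv.
  have -> : (fun h => v ((h *: delta_mx 0 k + x) 0 l)) =
            v \o (fun h => h * (k == l)%:R + x 0 l).
    by apply/funext => h /=; rewrite !mxE eqxx /= (eq_sym l).
  apply: is_derive1_comp; first by rewrite mul0r add0r.
  apply: is_derive_eq; rewrite /GRing.scale /=; ring.
rewrite (@derive_val _ _ _ _ _ _ _ (is_derive1_mul (D u du i Du) (D w dw j Dw))).
rewrite !scale0r !add0r; ring.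
Qed.

Lemma invmx_diag (F : fieldType) (n : nat) (d : 'rV[F]_n) :
  (forall i, d 0 i != 0) -> invmx (diag_mx d) = diag_mx (map_mx GRing.inv d).
Proof.
move=> d0.
have dV : diag_mx d *m diag_mx (map_mx GRing.inv d) = 1%:M.
  rewrite mul_diag_mx; apply/matrixP => i j; rewrite !mxE.
  by rewrite mulrnAr divff.
have [du _] := mulmx1_unit dV.
by rewrite -[RHS](mulKmx du) dV mulmx1.
Qed.

(** Contracting with the inverse metric undoes the lowering of the first index: by symmetry of [g],
    the sum over [p] is an entry of [invmx (g x) *m g x], so only [a = nu] survives and no metric
    factor remains. *)
Lemma ricci_contraction (R : realType) (n : nat) (g : 'rV[R]_n -> 'M[R]_n) (x : 'rV[R]_n)
    (q mu : 'I_n) :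
    g x \in unitmx -> (g x)^T = g x ->
  ricci g x q mu = \sum_(a < n)
    (partial mu (christoffel g a q a) x - partial a (christoffel g a q mu) x
     + \sum_(b < n) christoffel g b q a x * christoffel g a b mu x
     - \sum_(b < n) christoffel g b q mu x * christoffel g a b a x).
Proof.
move=> gu gT; rewrite mxE exchange_big /=; apply: eq_bigr => nu _.
under eq_bigr do rewrite mulr_sumr.
rewrite exchange_big /= (bigD1 nu) //= [X in _ + X]big1 ?addr0 => [|a anu].
  under eq_bigr do rewrite mulrA.
  rewrite -mulr_suml.
  have -> : \sum_(p < n) invmx (g x) p nu * g x p nu = 1.
    have /matrixP/(_ nu nu) := mulVmx gu; rewrite !mxE eqxx => e; apply: etrans e.
    by apply: eq_bigr => p _; rewrite -[in LHS]gT -trmx_inv mxE gT.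
  by rewrite mul1r.
under eq_bigr do rewrite mulrA.
rewrite -mulr_suml.
have -> : \sum_(p < n) invmx (g x) p nu * g x p a = 0.
  have /matrixP/(_ nu a) := mulVmx gu; rewrite !mxE eq_sym (negPf anu) => e; apply: etrans e.
  by apply: eq_bigr => p _; rewrite -[in LHS]gT -trmx_inv mxE gT.
by rewrite mul0r.
Qed.

(** The inverse metric is diagonal too, so only [d = a] contributes, and off-diagonal metric entries
    are constantly zero. *)
Lemma christoffel_diag (R : realType) (n : nat) (d : 'rV[R]_n -> 'rV[R]_n) (x : 'rV[R]_n)
    (a b c : 'I_n) :
    (forall i, d x 0 i != 0) ->
  christoffel (fun y => diag_mx (d y)) a b c x =
    (2 * d x 0 a)^-1 *
      (partial b (fun y => d y 0 a) x *+ (a == c)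
       + partial c (fun y => d y 0 a) x *+ (a == b)
       - partial a (fun y => d y 0 b) x *+ (b == c)).
Proof.
move=> dx0.
have pE k i j : partial k (fun y => diag_mx (d y) i j) x =
    partial k (fun y => d y 0 i) x *+ (i == j).
  rewrite /partial; case: eqVneq => [->|/negPf ij].
    by congr derive; apply/funext => y; rewrite mxE eqxx.
  have -> : (fun y => diag_mx (d y) i j) = cst 0.
    by apply/funext => y; rewrite mxE ij.
  by rewrite derive_cst.
rewrite /christoffel invmx_diag // (bigD1 a) //= [X in _ + X]big1 ?addr0 => [|k ka].
  by rewrite !pE !mxE eqxx mulr1n invfM mulrA.
by rewrite !mxE eq_sym (negPf ka) mul0r.
Qed.

Lemma is_derive1_div (R : realType) (u w : R -> R) (x du dw : R) :
  w x != 0 -> is_derive x 1 u du -> is_derive x 1 w dw ->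
  is_derive x 1 (fun y => u y / w y) ((du * w x - u x * dw) / w x ^+ 2).
Proof.
move=> w0 Du Dw; apply: is_derive_eq (is_derive1_mul Du (is_deriveV w0 Dw)) _.
by rewrite /GRing.scale /=; field.
Qed.

(** * Curvature of static metrics with an arbitrary lapse *)

Section StaticMetric.
Variables (R : realType) (f f1 f2 : R -> R) (U : set R).
Hypothesis openU : open U.
Hypothesis U_neq0 : forall r, U r -> r != 0.
Hypothesis f_neq0 : forall r, U r -> f r != 0.
Hypothesis f_derive : forall r, U r -> is_derive r 1 f (f1 r).
Hypothesis f1_derive : forall r, U r -> is_derive r 1 f1 (f2 r).

Definition static_metric (x : 'rV[R]_4) : 'M[R]_4 :=
  diag_mx (row4 (- f (r_coord x)) (f (r_coord x))^-1 (r_coord x ^+ 2)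
                (r_coord x ^+ 2 * sin (theta_coord x) ^+ 2)).

Definition static_regular : set 'rV[R]_4 :=
  [set x | U (r_coord x) /\ sin (theta_coord x) != 0].

(* The i-th diagonal coefficient of the metric is metric_rad i r * metric_ang i t,
   and Gamma^a_{bc} is gamma_rad a b c r * gamma_ang a b c t; the primed
   functions are the derivatives of the factors. *)
Definition metric_rad (i : nat) (r : R) : R :=
  match i with 0 => - f r | 1 => (f r)^-1 | _ => r ^+ 2 end.

Definition metric_rad' (i : nat) (r : R) : R :=
  match i with 0 => - f1 r | 1 => - f1 r / f r ^+ 2 | _ => 2 * r end.

Definition metric_ang (i : nat) (t : R) : R :=
  if i is 3 then sin t ^+ 2 else 1.

Definition metric_ang' (i : nat) (t : R) : R :=
  if i is 3 then 2 * sin t * cos t else 0.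

Definition gamma_rad (a b c : nat) (r : R) : R :=
  match a, b, c with
  | 0, 0, 1 | 0, 1, 0 => f1 r / (2 * f r)
  | 1, 0, 0 => f r * f1 r / 2
  | 1, 1, 1 => - f1 r / (2 * f r)
  | 1, 2, 2 | 1, 3, 3 => - r * f r
  | 2, 1, 2 | 2, 2, 1 | 3, 1, 3 | 3, 3, 1 => 1 / r
  | 2, 3, 3 | 3, 2, 3 | 3, 3, 2 => 1
  | _, _, _ => 0
  end.

Definition gamma_rad' (a b c : nat) (r : R) : R :=
  match a, b, c with
  | 0, 0, 1 | 0, 1, 0 => (f2 r * f r - f1 r ^+ 2) / (2 * f r ^+ 2)
  | 1, 0, 0 => (f1 r ^+ 2 + f r * f2 r) / 2
  | 1, 1, 1 => - (f2 r * f r - f1 r ^+ 2) / (2 * f r ^+ 2)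
  | 1, 2, 2 | 1, 3, 3 => - f r - r * f1 r
  | 2, 1, 2 | 2, 2, 1 | 3, 1, 3 | 3, 3, 1 => - 1 / r ^+ 2
  | _, _, _ => 0
  end.

Definition gamma_ang (a b c : nat) (t : R) : R :=
  match a, b, c with
  | 1, 3, 3 => sin t ^+ 2
  | 2, 3, 3 => - sin t * cos t
  | 3, 2, 3 | 3, 3, 2 => cos t / sin t
  | _, _, _ => 1
  end.

Definition gamma_ang' (a b c : nat) (t : R) : R :=
  match a, b, c with
  | 1, 3, 3 => 2 * sin t * cos t
  | 2, 3, 3 => sin t ^+ 2 - cos t ^+ 2
  | 3, 2, 3 | 3, 3, 2 => - 1 - cos t ^+ 2 / sin t ^+ 2
  | _, _, _ => 0
  end.

Lemma static_metricE (x : 'rV[R]_4) :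
  static_metric x =
    diag_mx (\row_i (metric_rad i (r_coord x) * metric_ang i (theta_coord x))).
Proof.
congr diag_mx; apply/rowP => i; rewrite !mxE.
by case: i => [[|[|[|[|//]]]] Hi] /=; rewrite ?mulr1.
Qed.

Lemma is_derive_metric_rad i r : U r ->
  is_derive r 1 (metric_rad i) (metric_rad' i r).
Proof.
move=> Ur; have Df := f_derive Ur.
case: i => [|[|i]]; rewrite /metric_rad /metric_rad'.
- exact: is_deriveN.
- apply: is_derive_eq (is_deriveV (f_neq0 Ur) Df) _.
  by rewrite /GRing.scale /= !mulNr mulrC.
- apply: is_derive_eq (is_deriveX 2 (is_derive_id r 1)) _.
  by rewrite /GRing.scale /=; ring.
Qed.

Lemma is_derive_metric_ang i (t : R) :
  is_derive t 1 (metric_ang i) (metric_ang' i t).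
Proof.
have D1 : is_derive t 1 (fun=> 1 : R) 0 := is_derive_cst _ _ _.
case: i => [|[|[|[|i]]]]; rewrite /metric_ang /metric_ang' //.
apply: is_derive_eq (is_deriveX 2 (is_derive_sin t)) _.
by rewrite /GRing.scale /=; ring.
Qed.

Lemma is_derive_gamma_rad a b c r : U r ->
  is_derive r 1 (gamma_rad a b c) (gamma_rad' a b c r).
Proof.
move=> Ur; have Df := f_derive Ur; have Df1 := f1_derive Ur.
have f0 := f_neq0 Ur; have r0 := U_neq0 Ur.
have Dc (k : R) : is_derive r 1 (fun=> k : R) 0 := is_derive_cst _ _ _.
have Dr : is_derive r 1 (fun y : R => y) 1 := is_derive_id _ _.
have D2f := is_derive1_mul (Dc 2) Df.
have n2 : 2 != 0 :> R by rewrite pnatr_eq0.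
have f20 : 2 * f r != 0 by rewrite mulf_neq0.
(* One derivative for each nonconstant shape of radial factor: [1 / r], [f1 / (2 f)], its opposite,
   [f f1 / 2] and [- r f]. *)
have DV := is_derive1_div (w := id) r0 (Dc 1) Dr.
have Dtt := is_derive1_div (w := fun y => 2 * f y) f20 Df1 D2f.
have Drr := is_derive1_div (u := fun y => - f1 y) (w := fun y => 2 * f y)
  f20 (is_deriveN Df1) D2f.
have Dff := is_derive1_div (w := fun=> 2) n2 (is_derive1_mul Df Df1) (Dc 2).
have Drf := is_derive1_mul (u := fun y => - y) (is_deriveN Dr) Df.
case: a => [|[|[|[|a]]]]; case: b => [|[|[|[|b]]]]; case: c => [|[|[|[|c]]]];
  rewrite /gamma_rad /gamma_rad';
  first [ exact: Dc
        | apply: is_derive_eq Dtt _; (field; by rewrite ?f0 ?r0)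
        | apply: is_derive_eq Drr _; rewrite /=; (field; by rewrite ?f0 ?r0)
        | apply: is_derive_eq Dff _; by field
        | apply: is_derive_eq Drf _; rewrite /=; ring
        | apply: is_derive_eq DV _; (field; by rewrite ?f0 ?r0) ].
Qed.

(** The derivative of the cotangent is kept as [- 1 - cos ^ 2 / sin ^ 2]: in this form sine and
    cosine can be treated as independent variables, here and in the Ricci tensor, without the
    Pythagorean identity. *)
Lemma is_derive_gamma_ang a b c (t : R) : sin t != 0 ->
  is_derive t 1 (gamma_ang a b c) (gamma_ang' a b c t).
Proof.
move=> s0.
have Dc (k : R) : is_derive t 1 (fun=> k : R) 0 := is_derive_cst _ _ _.
have Ds := is_derive_sin t; have Dcos := is_derive_cos t.
have Dss := is_deriveX 2 Ds.
have Dsc := is_derive1_mul (u := fun y => - sin y) (is_deriveN Ds) Dcos.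
have Dcot := is_derive1_div (w := sin) s0 Dcos Ds.
case: a => [|[|[|[|a]]]]; case: b => [|[|[|[|b]]]]; case: c => [|[|[|[|c]]]];
  rewrite /gamma_ang /gamma_ang';
  first [ exact: Dc
        | apply: is_derive_eq Dss _; rewrite /GRing.scale /=; ring
        | apply: is_derive_eq Dsc _; rewrite /=; ring
        | apply: is_derive_eq Dcot _; rewrite /=; by field ].
Qed.

(** For a vanishing symbol the radial factor is 0, so the default angular factor 1 is harmless. *)
Lemma christoffel_static (a b c : 'I_4) (x : 'rV[R]_4) : static_regular x ->
  christoffel static_metric a b c x =
    gamma_rad a b c (r_coord x) * gamma_ang a b c (theta_coord x).
Proof.
case=> Ur s0; have f0 := f_neq0 Ur; have r0 := U_neq0 Ur.
have -> : static_metric = fun y => diag_mx (\row_i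
    (metric_rad i (r_coord y) * metric_ang i (theta_coord y))).
  by apply/funext => y; exact: static_metricE.
rewrite christoffel_diag => [|i]; last first.
  rewrite !mxE.
  by case: i => [[|[|[|[|//]]]] Hi] /=;
    rewrite ?mulr1 ?oppr_eq0 ?invr_eq0 ?mulf_neq0 ?expf_neq0.
have pE (k i : 'I_4) : partial k (fun y => (\row_i
    (metric_rad i (r_coord y) * metric_ang i (theta_coord y))) 0 i) x =
   (k == 1 :> nat)%:R * (metric_rad' i (r_coord x) * metric_ang i (theta_coord x))
   + (k == 2 :> nat)%:R * (metric_rad i (r_coord x) * metric_ang' i (theta_coord x)).
  rewrite -(partial_separated _ (is_derive_metric_rad i Ur) (is_derive_metric_ang i _)).
  by congr (partial k _ x); apply/funext => y; rewrite mxE.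
rewrite !pE mxE -!(inj_eq val_inj) /=.
move: s0 Ur f0 r0; move: (r_coord x) (theta_coord x) => r t s0 Ur f0 r0.
case: a => [[|[|[|[|//]]]] Ha]; case: b => [[|[|[|[|//]]]] Hb];
  case: c => [[|[|[|[|//]]]] Hc]; rewrite /= ?mulr0n ?mulr1n; field;
  by rewrite ?f0 ?r0 ?s0.
Qed.

Lemma open_static_regular : open static_regular.
Proof.
have -> : static_regular = (r_coord (R := R)) @^-1` U `&`
    (sin \o theta_coord (R := R)) @^-1` [set s | s != 0] by [].
apply: openI; apply: open_comp => //=.
- by move=> y _; exact: coord_continuous.
- move=> y _; apply: continuous_comp; first exact: coord_continuous.
  exact: continuous_sin.
Qed.

Lemma partial_christoffel_static (a b c k : 'I_4) (x : 'rV[R]_4) : static_regular x ->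
  partial k (christoffel static_metric a b c) x =
    (k == 1 :> nat)%:R * (gamma_rad' a b c (r_coord x) * gamma_ang a b c (theta_coord x))
    + (k == 2 :> nat)%:R * (gamma_rad a b c (r_coord x) * gamma_ang' a b c (theta_coord x)).
Proof.
move=> Vx; have [Ur s0] := Vx.
rewrite -(partial_separated _ (is_derive_gamma_rad a b c Ur) (is_derive_gamma_ang a b c s0)).
(* The closed form of the symbols holds only at regular points; these form an open set, so it holds
   near [x] and may be differentiated. *)
apply: near_eq_derive.
have : \forall y \near x, static_regular y
  by apply: open_nbhs_nbhs; split=> //; exact: open_static_regular.
by apply: filterS => y; exact: christoffel_static.
Qed.

(** Relative to the metric, [l] is the eigenvalue on the (t, r)-plane and [u / r ^ 2] the one on the
    (theta, phi)-plane. *)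
Lemma ricci_static (x : 'rV[R]_4) : static_regular x ->
  let r := r_coord x in
  let l := (f2 r + 2 * f1 r / r) / 2 in
  let u := f r + r * f1 r - 1 in
  ricci static_metric x =
    diag_mx (row4 (- f r * l) (l / f r) u (u * sin (theta_coord x) ^+ 2)).
Proof.
move=> Vx /=; have [Ur s0] := Vx; have f0 := f_neq0 Ur; have r0 := U_neq0 Ur.
apply/matrixP => q mu; rewrite ricci_contraction.
- under eq_bigr => a _.
    rewrite !partial_christoffel_static //.
    under eq_bigr do rewrite !christoffel_static //.
    under [X in _ - X]eq_bigr do rewrite !christoffel_static //.
    over.
  rewrite !mxE -(inj_eq val_inj) !big_ord_recr !big_ord0 /=.
  (* With all sums expanded, each of the 16 entries is a rational identity in [r], the values of
     [f], [f1], [f2], and the sine and cosine of [t]. *)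
  move: s0 Ur f0 r0 {Vx}; move: (r_coord x) (theta_coord x) => r t s0 Ur f0 r0.
  case: q => [[|[|[|[|//]]]] Hq]; case: mu => [[|[|[|[|//]]]] Hmu];
    rewrite /= ?mulr0n ?mulr1n; field; by rewrite ?f0 ?r0 ?s0.
- rewrite unitmxE det_diag unitfE; apply/prodf_neq0 => i _; rewrite mxE.
  by case: i => [[|[|[|[|//]]]] Hi] /=;
    rewrite ?oppr_eq0 ?invr_eq0 ?mulf_neq0 ?expf_neq0.
- exact: tr_diag_mx.
Qed.

End StaticMetric.

(** * The Hayward lapse, its Ricci tensor and the rank of S - c g *)

Section Hayward.
Variables (R : realType) (m b : R).
Hypotheses (hm : 0 < m) (hb : 0 < b).

Let B := hayward_B m b.
Let B1 := hayward_B1 m b.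

Definition hayward_lapse (r : R) : R := B r / B1 r.

(** Since [B = B1 - 2 m r ^ 2], the lapse is [1 - 2 m r ^ 2 / B1]; hence the factor [2 m] in both
    derivatives. *)
Definition hayward_lapse' (r : R) : R :=
  2 * m * (r ^+ 4 - 4 * b ^+ 2 * m * r) / B1 r ^+ 2.

Definition hayward_lapse'' (r : R) : R :=
  2 * m * ((4 * r ^+ 3 - 4 * b ^+ 2 * m) * B1 r
           - 6 * r ^+ 2 * (r ^+ 4 - 4 * b ^+ 2 * m * r)) / B1 r ^+ 3.

Lemma hayward_B1_neq0 r : 0 < r -> B1 r != 0.
Proof.
by move=> r0; rewrite gt_eqF // addr_gt0 ?exprn_gt0 // !mulr_gt0 ?exprn_gt0.
Qed.

(** Turns the derivative of a polynomial function into a formal derivative, computed by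
    rewriting. *)
Lemma is_derive_horner (p : {poly R}) (h : R -> R) (r dh : R) :
  h =1 horner p -> (deriv p).[r] = dh -> is_derive r 1 h dh.
Proof. by move=> /funext -> <-; exact: is_derive_poly. Qed.

Lemma is_derive_hayward_B (r : R) : is_derive r 1 B (3 * r ^+ 2 - 4 * m * r).
Proof.
apply: (@is_derive_horner ((2 * b ^+ 2 * m)%:P + 'X^2 * ('X - (2 * m)%:P))).
  by move=> s; rewrite /B /B1 /hayward_B /hayward_B1 !hornerE; ring.
rewrite !derivCE !hornerE /=; ring.
Qed.

Lemma is_derive_hayward_B1 (r : R) : is_derive r 1 B1 (3 * r ^+ 2).
Proof.
apply: (@is_derive_horner ((2 * b ^+ 2 * m)%:P + 'X^3)).
  by move=> s; rewrite /B /B1 /hayward_B /hayward_B1 !hornerE; ring.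
rewrite !derivCE !hornerE /=; ring.
Qed.

Lemma is_derive_hayward_lapse (r : R) : 0 < r ->
  is_derive r 1 hayward_lapse (hayward_lapse' r).
Proof.
move=> r0; have n0 := hayward_B1_neq0 r0.
apply: is_derive_eq (is_derive1_div n0 (is_derive_hayward_B r) (is_derive_hayward_B1 r)) _.
by rewrite /hayward_lapse' /B /B1 /hayward_B /hayward_B1; field.
Qed.

Lemma is_derive_hayward_lapse' (r : R) : 0 < r ->
  is_derive r 1 hayward_lapse' (hayward_lapse'' r).
Proof.
move=> r0; have n0 := hayward_B1_neq0 r0.
have Dn : is_derive r 1 (fun s => 2 * m * (s ^+ 4 - 4 * b ^+ 2 * m * s))
    (2 * m * (4 * r ^+ 3 - 4 * b ^+ 2 * m)).
  apply: (@is_derive_horner ((2 * m)%:P * ('X^4 - (4 * b ^+ 2 * m)%:P * 'X))).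
    by move=> s; rewrite /B /B1 /hayward_B /hayward_B1 !hornerE; ring.
  rewrite !derivCE !hornerE /=; ring.
have D1 := is_derive1_mul (is_derive_hayward_B1 r) (is_derive_hayward_B1 r).
have := is_derive1_div (w := fun s => B1 s * B1 s) (mulf_neq0 n0 n0) Dn D1.
move/is_derive_eq; apply.
by rewrite /hayward_lapse''; field.
Qed.

(** Plays the part of [U] for static metrics: positivity keeps [r] and [B1] nonzero, and [B r != 0]
    keeps the lapse nonzero. *)
Definition hayward_radii : set R := [set r | 0 < r] `&` [set r | B r != 0].

Lemma open_hayward_radii : open hayward_radii.
Proof.
apply: openI; first exact: open_gt.
apply: (@open_comp _ _ B [set s | s != 0]); last exact: open_neq.
move=> r _; apply: differentiable_continuous; apply/derivable1_diffP.
exact: (@ex_derive _ _ _ _ _ _ _ (is_derive_hayward_B r)).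
Qed.

Lemma hayward_metricE : hayward_metric m b = static_metric hayward_lapse.
Proof.
by apply/funext => x; rewrite /hayward_metric /static_metric /hayward_lapse invf_div.
Qed.

(* The eigenvalue of the Ricci tensor on the (t, r)-plane minus [hayward_alpha],
   its eigenvalue on the (theta, phi)-plane. *)
Definition hayward_gap (x : 'rV[R]_4) : R :=
  36 * b ^+ 2 * m ^+ 2 * r_coord x ^+ 3 / B1 (r_coord x) ^+ 3.

(** In [f + r f' - 1] the terms in [r ^ 5] cancel over the denominator [B1 ^ 2], leaving
    [- 12 b ^ 2 m ^ 2 r ^ 2 / B1 ^ 2], which is alpha times [r ^ 2]; the second summand corrects the
    (t, r)-block. *)
Lemma ricci_hayward x : hayward_domain m b x ->
  let f := hayward_lapse (r_coord x) in
  ricci (hayward_metric m b) x =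
    hayward_alpha m b x *: hayward_metric m b x
    + hayward_gap x *: diag_mx (row4 (- f) f^-1 0 0).
Proof.
case=> r0 t0 B0 /=; have n0 := hayward_B1_neq0 r0.
have s0 : sin (theta_coord x) != 0 by rewrite gt_eqF // sin_gt0_pi.
have U0 r : hayward_radii r -> r != 0 by case=> /= r1 _; rewrite gt_eqF.
have Uf r : hayward_radii r -> hayward_lapse r != 0.
  by case=> /= r1 B2; rewrite mulf_neq0 ?invr_eq0 ?hayward_B1_neq0.
have UD (r : R) : hayward_radii r -> is_derive r 1 hayward_lapse (hayward_lapse' r).
  by case=> /= r1 _; exact: is_derive_hayward_lapse.
have UD' (r : R) : hayward_radii r -> is_derive r 1 hayward_lapse' (hayward_lapse'' r).
  by case=> /= r1 _; exact: is_derive_hayward_lapse'.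
rewrite hayward_metricE (ricci_static open_hayward_radii U0 Uf UD UD') //.
rewrite /hayward_alpha /static_metric /hayward_gap.
move: s0 r0 n0 B0 {t0}; move: (r_coord x) (theta_coord x) => r t s0 r0 n0 B0.
have rn0 : r != 0 by rewrite gt_eqF.
apply/matrixP => i j; rewrite !mxE -(inj_eq val_inj).
move: B0 n0; rewrite /hayward_lapse /hayward_lapse' /hayward_lapse'' /B /B1 /hayward_B
   /hayward_B1 => B0 n0.
case: i => [[|[|[|[|//]]]] Hi]; case: j => [[|[|[|[|//]]]] Hj];
  rewrite /= ?mulr0n ?mulr1n; field; by rewrite ?B0 ?n0 ?rn0.
Qed.

Lemma hayward_gap_neq0 x : hayward_domain m b x -> hayward_gap x != 0.
Proof.
case=> r0 _ _; have n0 := hayward_B1_neq0 r0.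
by rewrite !mulf_neq0 ?invr_eq0 ?expf_neq0 ?pnatr_eq0 ?(gt_eqF hm) ?(gt_eqF hb) ?(gt_eqF r0).
Qed.

(** Each eigenvalue occurs on two diagonal entries with nonzero metric coefficients, so it
    contributes 2 to the rank unless it equals [c]. Leaving [c] free settles ranks 0, 1 and 2 at
    once. *)
Lemma rank_ricci_hayward x c : hayward_domain m b x ->
  \rank (ricci (hayward_metric m b) x - c *: hayward_metric m b x) =
    (2 * (c != hayward_alpha m b x + hayward_gap x)%R
     + 2 * (c != hayward_alpha m b x))%N.
Proof.
move=> Mx; rewrite ricci_hayward //; have [r0 t0 B0] := Mx.
have n0 := hayward_B1_neq0 r0.
have s0 : sin (theta_coord x) != 0 by rewrite gt_eqF // sin_gt0_pi.
have f0 : hayward_lapse (r_coord x) != 0 by rewrite mulf_neq0 ?invr_eq0.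
rewrite hayward_metricE /static_metric.
move: (hayward_lapse _) f0 (hayward_alpha _ _ _) (hayward_gap _) => f f0 al la.
set r := r_coord x; set t := theta_coord x.
have -> : al *: diag_mx (row4 (- f) f^-1 (r ^+ 2) (r ^+ 2 * sin t ^+ 2))
    + la *: diag_mx (row4 (- f) f^-1 0 0)
    - c *: diag_mx (row4 (- f) f^-1 (r ^+ 2) (r ^+ 2 * sin t ^+ 2)) =
  diag_mx (row4 ((al + la - c) * - f) ((al + la - c) * f^-1) ((al - c) * r ^+ 2)
                ((al - c) * (r ^+ 2 * sin t ^+ 2))).
  apply/matrixP => i j; rewrite !mxE.
  case: i => [[|[|[|[|//]]]] Hi]; case: (_ == _); rewrite /= ?mulr0n ?mulr1n; ring.
rewrite mxrank_diag !big_ord_recl big_ord0 !mxE /=.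
have rn0 : r != 0 by rewrite gt_eqF.
have mulI_eq0 (u v : R) : v != 0 -> (u * v == 0) = (u == 0).
  by move=> v0; rewrite mulf_eq0 (negPf v0) orbF.
rewrite !mulI_eq0 ?oppr_eq0 ?invr_eq0 ?mulf_neq0 ?expf_neq0 //.
rewrite !subr_eq0 !(eq_sym c).
by case: (_ == _); case: (_ == _).
Qed.

(** On an empty domain every rank condition would hold vacuously, so the two negative claims need a
    point. *)
Lemma hayward_domain_nonempty : hayward_domain m b !=set0.
Proof.
(* At [r = 2 m] the second term of [B] vanishes, leaving [2 b ^ 2 m], which is positive. *)
exists (row4 0 (2 * m) (pi / 2) 0); split; rewrite /r_coord /theta_coord !mxE /=.
- by rewrite mulr_gt0.
- by have := pi_gt0 R; lra.
- by rewrite /hayward_B subrr mulr0 addr0 !mulf_neq0 ?expf_neq0 ?pnatr_eq0 ?gt_eqF.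
Qed.

End Hayward.

Theorem proposition3p1 (R : realType) (m b : R) (hm : 0 < m) (hb : 0 < b) :
  let M := hayward_domain m b in
  let g := hayward_metric m b in
  [/\ ~ einstein M g,
      ~ quasi_einstein M g,
      two_quasi_einstein_with M g (hayward_alpha m b)
    & chaki_generalized_quasi_einstein_with M g (hayward_alpha m b)
        (fun=> 1) (fun=> 1) (hayward_Pi m b) (hayward_Phi m b)].
Proof.
move=> M g; have [x0 Mx0] := hayward_domain_nonempty hm hb.
have gap x : M x -> hayward_alpha m b x != hayward_alpha m b x + hayward_gap m b x.
  by move=> /(hayward_gap_neq0 hm hb); apply: contraNneq => e; apply/eqP; lra.
split.
(* Rank 0 would force the value of [a] to equal both eigenvalues, which the gap separates. *)
- case=> a /(_ _ Mx0); rewrite rank_ricci_hayward // => /eqP.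
  rewrite addn_eq0 !muln_eq0 /= !eqb0 !negbK => /andP[/eqP -> /eqP e].
  by move: (gap _ Mx0); rewrite e eqxx.
(* The rank is a sum of terms 0 or 2, hence never 1. *)
- case=> a /(_ _ Mx0); rewrite rank_ricci_hayward //.
  by case: (_ != _); case: (_ != _).
- by move=> x Mx; rewrite rank_ricci_hayward // gap // eqxx.
- move=> x Mx; rewrite ricci_hayward //; have [r0 t0 B0] := Mx.
  have n0 := hayward_B1_neq0 hm hb r0.
  (* What remains is a factorisation into null forms: with f the lapse, [- f dt^2 + dr^2 / f] is the
     product of [Pi = - f dt + dr] and [(f dt + dr) / f], while [Phi + Pi / 2] is half the gap times
     [(f dt + dr) / f]. *)
  rewrite -addrA; congr (_ + _).
  rewrite /hayward_gap /hayward_lapse /hayward_Pi /hayward_Phi /form_tensor.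
  move: B0 n0; move: (r_coord x) => r.
  move: (hayward_B _ _ _) (hayward_B1 _ _ _) => B B1 B0 n0.
  apply/matrixP => i j; rewrite !mxE !big_ord1 !mxE -(inj_eq val_inj).
  case: i => [[|[|[|[|//]]]] Hi]; case: j => [[|[|[|[|//]]]] Hj];
    rewrite /= ?mulr0n ?mulr1n; field; by rewrite ?B0 ?n0.
Qed.
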